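(* Let $k$ be a commutative Noetherian ring, $A$ a unital $k$-algebra with $k$-involution, and $J$ an affine cell ideal of $A$ with cell lattice $\Delta=V\otimes_kB$, where $V$ is free of rank $n$ over $k$. Suppose one of the following conditions holds: (a) $J$ is an idempotent ideal, i.e. $J^2=J$; or (b) $J$ contains an element that is a central non-zero divisor in the ring $J$. Then $\mathrm{End}({}_AJ)=\mathrm{End}({}_JJ)\simeq M_n(B)$ and $\mathrm{End}({}_A\Delta)\simeq B$ as rings.
   Context: All rings are associative, not necessarily unital. Products in endomorphism rings of left modules are formed by applying the left factor first, so that right multiplication gives a ring homomorphism. Affine cell ideals: let $A$ be a unital $k$-algebra with a $k$-involution $i$ ($k$-linear anti-automorphism with $i^2=\mathrm{id}$). A two-sided ideal $J$ is an affine cell ideal if: (1) $i(J)=J$; (2) there are a free $k$-module $V$ of finite rank $n\ge1$ and an affine (finitely generated) commutative unital $k$-algebra $B$ with a $k$-involution $\sigma$ such that $\Delta:=V\otimes_kB$ is an $A$-$B$-bimodule, with right $B$-structure induced by $B_B$; (3) there is an $A$-$A$-bimodule isomorphism $\alpha:J\to\Delta\otimes_B\Delta'$, where $\Delta'=B\otimes_kV$ is the $B$-$A$-bimodule with left $B$-structure induced by ${}_BB$ and right $A$-structure $(b\otimes v)a:=\tau(i(a)(v\otimes b))$, $\tau:\Delta\to\Delta'$ being the flip, such that $\alpha\circ i=\theta\circ\alpha$ with $\theta(v_1\otimes b_1\otimes_Bb_2\otimes v_2)=v_2\otimes\sigma(b_2)\otimes_B\sigma(b_1)\otimes v_1$.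 The module $\Delta$ is called the cell lattice of $J$. Identify $\Delta\otimes_B\Delta'$ with $V\otimes_kB\otimes_kV$ and fix a basis $v_1,\dots,v_n$ of $V$. Then there is a matrix $\psi=(\psi_{st})\in M_n(B)$ such that the multiplication of $J$, transported via $\alpha$, is $(v_i\otimes b\otimes v_j)(v_s\otimes c\otimes v_t)=v_i\otimes b\psi_{js}c\otimes v_t$. Hence $J$ is isomorphic as a ring to $M_n(B)$ with multiplication $a*b=a\psi b$, via $v_i\otimes b\otimes v_j\mapsto bE_{ij}$. *)

(* Defs.v *)
From HB Require Import structures.
From mathcomp Require Import all_boot all_algebra.
From mathcomp Require Import boolp.
From mathcomp Require Import freeg.

Set Implicit Arguments.
Unset Strict Implicit.
Unset Printing Implicit Defensive.

Import GRing.Theory.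

Local Open Scope ring_scope.
Local Open Scope quotient_scope.

(* A unital k-algebra, given by its structure map.  MathComp's [algType] and
   [comAlgType] are not used because they exclude the zero ring. *)
HB.mixin Record isPzAlgebra (k : comPzRingType) A of GRing.PzRing A := {
  alg_scalar : {rmorphism k -> A};
  alg_scalar_comm : forall (c : k) (x : A), alg_scalar c * x = x * alg_scalar c
}.

#[short(type="pzAlgType")]
HB.structure Definition PzAlgebra (k : comPzRingType) :=
  {A of GRing.PzRing A & isPzAlgebra k A}.

#[short(type="comPzAlgType")]
HB.structure Definition ComPzAlgebra (k : comPzRingType) :=
  {A of GRing.ComPzRing A & PzAlgebra k A}.

Definition alg_scale (k : comPzRingType) (A : pzAlgType k) (c : k) (x : A) : A :=
  alg_scalar c * x.

(* Membership is boolean; by excluded middle ([boolp]) every ideal is of this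
   form.  Ideals need not be proper. *)
HB.mixin Record isTwoSidedIdeal (R : pzRingType) (I : R -> bool) := {
  idealMl_subproof : forall a x : R, x \in I -> a * x \in I;
  idealMr_subproof : forall a x : R, x \in I -> x * a \in I
}.

#[short(type="twoSidedIdeal")]
HB.structure Definition TwoSidedIdeal (R : pzRingType) :=
  {I of GRing.ZmodClosed R I & isTwoSidedIdeal R I}.

Section IdealElements.
Variables (R : pzRingType) (I : twoSidedIdeal R).

Lemma idealMl (a x : R) : x \in I -> a * x \in I.
Proof. exact: idealMl_subproof. Qed.

Lemma idealMr (a x : R) : x \in I -> x * a \in I.
Proof. exact: idealMr_subproof. Qed.

Record ideal_elt := IdealElt { ideal_val : R; _ : ideal_val \in I }.

HB.instance Definition _ := [isSub for ideal_val].
HB.instance Definition _ := [Choice of ideal_elt by <:].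
HB.instance Definition _ := [SubChoice_isSubZmodule of ideal_elt by <:].

Definition ideal_lmul (a : R) (x : ideal_elt) : ideal_elt :=
  IdealElt (idealMl a (valP x)).

Definition ideal_rmul (x : ideal_elt) (a : R) : ideal_elt :=
  IdealElt (idealMr a (valP x)).

(* The product of the (non-unital) ring I. *)
Definition ideal_mul (x y : ideal_elt) : ideal_elt := ideal_lmul (val x) y.

Definition in_ideal_square (x : R) : Prop :=
  exists s : seq (ideal_elt * ideal_elt), x = \sum_(p <- s) val p.1 * val p.2.

Definition idempotent_ideal : Prop := forall x, in_ideal_square x <-> x \in I.

Definition ideal_central (z : ideal_elt) : Prop :=
  forall x : ideal_elt, ideal_mul z x = ideal_mul x z.

Definition ideal_non_zero_divisor (z : ideal_elt) : Prop :=
  forall x : ideal_elt, ideal_mul z x = 0 \/ ideal_mul x z = 0 -> x = 0.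

Fact ideal_lmul_is_zmod_morphism a : zmod_morphism (ideal_lmul a).
Proof. by move=> x y; apply: val_inj; rewrite /= mulrBr. Qed.

HB.instance Definition _ (a : R) :=
  GRing.isZmodMorphism.Build ideal_elt ideal_elt (ideal_lmul a)
    (ideal_lmul_is_zmod_morphism a).

End IdealElements.

Definition noetherian (k : comPzRingType) : Prop :=
  forall I : twoSidedIdeal k, exists s : seq k,
    forall x, x \in I <-> exists c : 'I_(size s) -> k,
                            x = \sum_(j < size s) c j * s`_j.

(* Finitely generated as a k-algebra: some finite s is contained in no proper
   unital k-subalgebra. *)
Definition affine_algebra (k : comPzRingType) (B : comPzAlgType k) : Prop :=
  exists s : seq B, forall S : {pred B},
    GRing.subring_closed S -> (forall c : k, alg_scalar c \in S) ->
    {subset s <= S} -> forall b, b \in S.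

Record k_involution (k : comPzRingType) (A : pzAlgType k) (i : A -> A) : Prop := {
  kinv_add : {morph i : x y / x + y};
  kinv_scale : forall c, {morph i : x / alg_scale c x};
  kinv_one : i 1 = 1;
  kinv_mul : {morph i : x y / x * y >-> y * x};
  kinv_involutive : involutive i
}.

Definition free_of_rank (k : comPzRingType) (V : lmodType k) (n : nat) : Prop :=
  exists e : 'I_n -> V,
    forall v, exists! c : 'rV[k]_n, v = \sum_(j < n) c 0 j *: e j.

Section AdditiveEndomorphisms.
Variable M : zmodType.

Record addEnd := AddEnd { addEnd_map :> {additive M -> M} }.

HB.instance Definition _ := gen_eqMixin addEnd.
HB.instance Definition _ := gen_choiceMixin addEnd.

Lemma addEnd_eq (f g : addEnd) : f =1 g -> f = g.
Proof.
case: f g => [[f [[f0]]]] [[g [[g0]]]] /= /funext efg.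
case: _ / efg g0 => g0.
by rewrite (Prop_irrelevance f0 g0).
Qed.

Definition addEnd_zero : addEnd := AddEnd (\0%R : {additive M -> M}).
Definition addEnd_opp (f : addEnd) : addEnd :=
  AddEnd (GRing.opp_fun f : {additive M -> M}).
Definition addEnd_add (f g : addEnd) : addEnd :=
  AddEnd (GRing.add_fun f g : {additive M -> M}).

Fact addEnd_addA : associative addEnd_add.
Proof. by move=> f g h; apply: addEnd_eq => x; exact: addrA. Qed.
Fact addEnd_addC : commutative addEnd_add.
Proof. by move=> f g; apply: addEnd_eq => x; exact: addrC. Qed.
Fact addEnd_add0 : left_id addEnd_zero addEnd_add.
Proof. by move=> f; apply: addEnd_eq => x; exact: add0r. Qed.
Fact addEnd_addN : left_inverse addEnd_zero addEnd_opp addEnd_add.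
Proof. by move=> f; apply: addEnd_eq => x; exact: addNr. Qed.

HB.instance Definition _ := GRing.isZmodule.Build addEnd
  addEnd_addA addEnd_addC addEnd_add0 addEnd_addN.

Definition addEnd_one : addEnd := AddEnd (idfun : {additive M -> M}).

(* The left factor is applied first. *)
Definition addEnd_mul (f g : addEnd) : addEnd :=
  AddEnd (g \o f : {additive M -> M}).

Fact addEnd_mulA : associative addEnd_mul.
Proof. by move=> f g h; apply: addEnd_eq. Qed.
Fact addEnd_mul1l : left_id addEnd_one addEnd_mul.
Proof. by move=> f; apply: addEnd_eq. Qed.
Fact addEnd_mul1r : right_id addEnd_one addEnd_mul.
Proof. by move=> f; apply: addEnd_eq. Qed.
Fact addEnd_mulDl : left_distributive addEnd_mul +%R.
Proof. by move=> f g h; apply: addEnd_eq => x; exact: raddfD. Qed.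
Fact addEnd_mulDr : right_distributive addEnd_mul +%R.
Proof. by move=> f g h; apply: addEnd_eq. Qed.

HB.instance Definition _ := GRing.Zmodule_isPzRing.Build addEnd
  addEnd_mulA addEnd_mul1l addEnd_mul1r addEnd_mulDl addEnd_mulDr.

Lemma addEndBE (f g : addEnd) x : (f - g) x = f x - g x.
Proof. by []. Qed.

Lemma addEndME (f g : addEnd) x : (f * g) x = g (f x).
Proof. by []. Qed.

End AdditiveEndomorphisms.

(* End(_S M), for S a set or ring acting on the left of M by [act]. *)
Section ModuleEndomorphisms.
Variables (S : Type) (M : zmodType) (act : S -> addEnd M).

Definition module_end : {pred addEnd M} :=
  fun f => `[< forall (s : S) (x : M), f (act s x) = act s (f x) >].

Fact module_end_subring_closed : GRing.subring_closed module_end.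
Proof.
split; first exact/asboolP.
- move=> f g /asboolP fS /asboolP gS; apply/asboolP => s x.
  by rewrite !addEndBE fS gS raddfB.
move=> f g /asboolP fS /asboolP gS; apply/asboolP => s x.
by rewrite !addEndME fS gS.
Qed.

HB.instance Definition _ :=
  GRing.isSubringClosed.Build (addEnd M) module_end module_end_subring_closed.

Record module_end_ring :=
  ModuleEnd { module_end_val : addEnd M; _ : module_end_val \in module_end }.

HB.instance Definition _ := [isSub for module_end_val].
HB.instance Definition _ := [Choice of module_end_ring by <:].
HB.instance Definition _ :=
  GRing.SubChoice_isSubPzRing.Build _ _ module_end_ring
    (GRing.subringClosedP _).

End ModuleEndomorphisms.

Definition ring_isomorphic (R S : pzRingType) : Prop :=
  exists f : {rmorphism R -> S}, bijective f.

Section IdealModules.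
Variables (R : pzRingType) (I : twoSidedIdeal R).

Definition ideal_lact (a : R) : addEnd (ideal_elt I) :=
  AddEnd (ideal_lmul a : {additive ideal_elt I -> ideal_elt I}).

Definition ideal_self_lact (x : ideal_elt I) : addEnd (ideal_elt I) :=
  ideal_lact (val x).

End IdealModules.

(* M (x)_R N for a right action [ra] of R on M and a left action [la] on N. *)
Section Tensor.
Variables (R : Type) (M N : zmodType) (ra : M -> R -> M) (la : R -> N -> N).

Inductive tensor_relation : {freeg (M * N) / int} -> Prop :=
| tensor_rel0 : tensor_relation 0
| tensor_relB x y :
    tensor_relation x -> tensor_relation y -> tensor_relation (x - y)
| tensor_relDl m m' n :
    tensor_relation (<< (m + m', n) >> - << (m, n) >> - << (m', n) >>)
| tensor_relDr m n n' :
    tensor_relation (<< (m, n + n') >> - << (m, n) >> - << (m, n') >>)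
| tensor_rel_act m r n :
    tensor_relation (<< (ra m r, n) >> - << (m, la r n) >>).

Definition tensor_rel : {pred {freeg (M * N) / int}} :=
  fun x => `[< tensor_relation x >].

Fact tensor_rel_zmod_closed : zmod_closed tensor_rel.
Proof.
split=> [|x y /asboolP xR /asboolP yR]; apply/asboolP; first exact: tensor_rel0.
exact: tensor_relB.
Qed.

HB.instance Definition _ :=
  GRing.isZmodClosed.Build {freeg (M * N) / int} tensor_rel
    tensor_rel_zmod_closed.

Definition tensor : Type :=
  {ideal_quot (tensor_rel : zmodClosed {freeg (M * N) / int})}.

HB.instance Definition _ := GRing.Zmodule.on tensor.
HB.instance Definition _ := Quotient.on tensor.

Fact tensor_pi_is_zmod_morphism :
  zmod_morphism (\pi_tensor : {freeg (M * N) / int} -> tensor).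
Proof. exact: (pi_is_zmod_morphism {ideal_quot (tensor_rel : zmodClosed _)}). Qed.

HB.instance Definition _ :=
  GRing.isZmodMorphism.Build {freeg (M * N) / int} tensor \pi_tensor
    tensor_pi_is_zmod_morphism.

Definition tens (m : M) (n : N) : tensor := \pi_tensor << (m, n) >>.

Definition balanced (U : zmodType) (f : M -> N -> U) : Prop :=
  [/\ forall n, {morph f^~ n : m m' / m + m'},
      forall m, {morph f m : n n' / n + n'}
    & forall m r n, f (ra m r) n = f m (la r n)].

(* The additive map m (x) n |-> f m n; it is meaningful only for balanced f
   ([tensor_liftE] below). *)
Definition tensor_lift (U : zmodType) (f : M -> N -> U) (t : tensor) : U :=
  fglift (fun p : M * N => (f p.1 p.2 : zmodule U)) (repr t).

Fact tensor_pi_rel (x : {freeg (M * N) / int}) :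
  tensor_relation x -> \pi_tensor x = 0 :> tensor.
Proof.
move=> xR; rewrite -(raddf0 (\pi_tensor : {additive _ -> tensor})).
apply/eqP; rewrite -[_ == _]/(_ == _ %[mod {ideal_quot _}]).
by rewrite -Quotient.idealrBE subr0; apply/asboolP.
Qed.

Lemma tens_balanced : balanced tens.
Proof.
split=> [n m m'|m n n'|m r n] /=; apply/eqP; rewrite -subr_eq0 ?opprD ?addrA.
- by rewrite /tens -!raddfB; apply/eqP/tensor_pi_rel; exact: tensor_relDl.
- by rewrite /tens -!raddfB; apply/eqP/tensor_pi_rel; exact: tensor_relDr.
- by rewrite /tens -!raddfB; apply/eqP/tensor_pi_rel; exact: tensor_rel_act.
Qed.

Lemma tensor_ind (P : tensor -> Prop) :
    (forall m n, P (tens m n)) -> (forall x y, P x -> P y -> P (x - y)) ->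
  forall x, P x.
Proof.
move=> Ptens PB x; have P0 : P 0 by rewrite -(subrr (tens 0 0)); exact: PB.
have PD (y z : tensor) : P y -> P z -> P (y + z).
  by move=> Py Pz; rewrite -[z]opprK; apply: (PB) => //; rewrite -sub0r; exact: PB.
have PM (y : tensor) (c : int) : P y -> P (y *~ c).
  have Pn n : P y -> P (y *+ n).
    by move=> Py; elim: n => [|n IHn]; rewrite ?mulr0n // mulrS; exact: PD.
  case: c => n Py; first exact: Pn.
  by rewrite NegzE mulrNz -sub0r; apply: PB => //; exact: Pn.
rewrite -[x]reprK -(freeg_sumE (repr x)) raddf_sum.
elim/big_ind: _ => // p _; rewrite -[coeff _ _]intz -freegU_mulz.
by rewrite raddfMz; apply: PM; case: p => m n; exact: Ptens.
Qed.

Section Lift.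
Variables (U : zmodType) (f : M -> N -> U).
Hypothesis f_bal : balanced f.

Let F : {freeg (M * N) / int} -> U := fglift (fun p : M * N => f p.1 p.2 : zmodule U).

Let FB : {morph F : x y / x - y}.
Proof.
exact: (lift_is_additive (fun p : M * N => f p.1 p.2 : zmodule U)).
Qed.

Let FU p : F << p >> = f p.1 p.2.
Proof. by rewrite /F liftU scale1r. Qed.

Let F_rel x : tensor_relation x -> F x = 0.
Proof.
have [fDl fDr fact] := f_bal.
elim=> [|{}x y _ Fx _ Fy|m m' n|m n n'|m r n]; last 4 first.
- by rewrite FB Fx Fy subrr.
- by rewrite !FB !FU /= fDl addrAC addrK subrr.
- by rewrite !FB !FU /= fDr addrAC addrK subrr.
- by rewrite FB !FU /= fact subrr.
by have := FB 0 0; rewrite !subrr.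
Qed.

Let tensor_lift_pi x : tensor_lift f (\pi_tensor x) = F x.
Proof.
apply/eqP; rewrite -subr_eq0 -FB; apply/eqP/F_rel/asboolP.
by rewrite -[`[< _ >]]/(_ \in tensor_rel) Quotient.idealrBE reprK.
Qed.

Lemma tensor_liftB : {morph tensor_lift f : x y / x - y}.
Proof.
move=> x y; rewrite -[x]reprK -[y]reprK.
by rewrite -raddfB !tensor_lift_pi FB.
Qed.

Lemma tensor_liftE m n : tensor_lift f (tens m n) = f m n.
Proof. by rewrite tensor_lift_pi FU. Qed.

End Lift.
End Tensor.

Record left_action (R : pzRingType) (M : zmodType) (la : R -> M -> M) : Prop := {
  lactDl : forall m, {morph la^~ m : r s / r + s};
  lactDr : forall r, {morph la r : m m' / m + m'};
  lact1 : forall m, la 1 m = m;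
  lactM : forall r s m, la (r * s) m = la r (la s m)
}.

Record right_action (R : pzRingType) (M : zmodType) (ra : M -> R -> M) : Prop := {
  ractDl : forall r, {morph ra^~ r : m m' / m + m'};
  ractDr : forall m, {morph ra m : r s / r + s};
  ract1 : forall m, ra m 1 = m;
  ractM : forall r s m, ra m (r * s) = ra (ra m r) s
}.

(* Bimodules over k-algebras: the two actions induce the same action of k. *)
Record bimodule (k : comPzRingType) (A B : pzAlgType k) (M : zmodType)
    (la : A -> M -> M) (ra : M -> B -> M) : Prop := {
  bimod_left : left_action la;
  bimod_right : right_action ra;
  bimod_comm : forall a m b, ra (la a m) b = la a (ra m b);
  bimod_scalar : forall (c : k) m, la (alg_scalar c) m = ra m (alg_scalar c)
}.

Section CellLattice.
Variables (k : comPzRingType) (V : lmodType k) (B : comPzAlgType k).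

(* Delta = V (x)_k B *)
Definition cell_lattice : Type :=
  tensor (fun (v : V) (c : k) => c *: v) (fun (c : k) (b : B) => alg_scale c b).

HB.instance Definition _ := GRing.Zmodule.on cell_lattice.

Definition lat_tens (v : V) (b : B) : cell_lattice := tens _ _ v b.

(* (v (x) b) c = v (x) bc *)
Definition lat_ract (x : cell_lattice) (c : B) : cell_lattice :=
  tensor_lift (fun v b => lat_tens v (b * c)) x.

(* Delta' = B (x)_k V *)
Definition colattice : Type :=
  tensor (fun (b : B) (c : k) => alg_scale c b) (fun (c : k) (v : V) => c *: v).

HB.instance Definition _ := GRing.Zmodule.on colattice.

Definition colat_tens (b : B) (v : V) : colattice := tens _ _ b v.

(* c (b (x) v) = cb (x) v *)
Definition colat_lact (c : B) (y : colattice) : colattice :=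
  tensor_lift (fun b v => colat_tens (c * b) v) y.

(* v (x) b |-> b (x) v *)
Definition flip (x : cell_lattice) : colattice :=
  tensor_lift (fun v b => colat_tens b v) x.

(* Delta (x)_B Delta' *)
Definition cell_square : Type := tensor lat_ract colat_lact.

HB.instance Definition _ := GRing.Zmodule.on cell_square.

Definition sq_tens (x : cell_lattice) (y : colattice) : cell_square :=
  tens _ _ x y.

Section Theta.
Variable sigma : B -> B.

(* v (x) b |-> sigma b (x) v  and  b (x) v |-> v (x) sigma b *)
Definition lat_twist (x : cell_lattice) : colattice :=
  tensor_lift (fun v b => colat_tens (sigma b) v) x.

Definition colat_twist (y : colattice) : cell_lattice :=
  tensor_lift (fun b v => lat_tens v (sigma b)) y.

(* (v1 (x) b1) (x) (b2 (x) v2) |-> (v2 (x) sigma b2) (x) (sigma b1 (x) v1) *)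
Definition theta (z : cell_square) : cell_square :=
  tensor_lift (fun x y => sq_tens (colat_twist y) (lat_twist x)) z.

End Theta.

Section Actions.
Variables (A : pzAlgType k) (i : A -> A).
Variable lact : A -> addEnd cell_lattice.

(* (b (x) v) a = tau (i(a) (v (x) b)) *)
Definition colat_ract (y : colattice) (a : A) : colattice :=
  tensor_lift (fun b v => flip (lact (i a) (lat_tens v b))) y.

Definition sq_lact (a : A) (z : cell_square) : cell_square :=
  tensor_lift (fun x y => sq_tens (lact a x) y) z.

Definition sq_ract (z : cell_square) (a : A) : cell_square :=
  tensor_lift (fun x y => sq_tens x (colat_ract y a)) z.

End Actions.
End CellLattice.

Lemma zmod_morphismD (U W : zmodType) (f : U -> W) :
  zmod_morphism f -> {morph f : x y / x + y}.
Proof.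
move=> fB x y; have f0 : f 0 = 0 by have := fB 0 0; rewrite !subrr.
have fN z : f (- z) = - f z by rewrite -[- z]sub0r fB f0 sub0r.
by rewrite -{1}[y]opprK fB fN opprK.
Qed.

(* The maps above take the displayed values on pure tensors. *)
Section PureTensors.
Variables (k : comPzRingType) (V : lmodType k) (B : comPzAlgType k).
Implicit Types (v : V) (b c : B).

Lemma lat_ind (P : cell_lattice V B -> Prop) :
    (forall v b, P (lat_tens v b)) -> (forall x y, P x -> P y -> P (x - y)) ->
  forall x, P x.
Proof. exact: tensor_ind. Qed.

Lemma colat_ind (P : colattice V B -> Prop) :
    (forall b v, P (colat_tens b v)) -> (forall x y, P x -> P y -> P (x - y)) ->
  forall x, P x.
Proof. exact: tensor_ind. Qed.

Lemma lat_tens_balanced : balanced (fun v (c : k) => c *: v)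
  (fun (c : k) b => alg_scale c b) (@lat_tens k V B).
Proof. exact: tens_balanced. Qed.

Lemma colat_tens_balanced : balanced (fun b (c : k) => alg_scale c b)
  (fun (c : k) v => c *: v) (@colat_tens k V B).
Proof. exact: tens_balanced. Qed.

Lemma sq_tens_balanced :
  balanced (@lat_ract k V B) (@colat_lact k V B) (@sq_tens k V B).
Proof. exact: tens_balanced. Qed.

Lemma lat_ract_balanced c : balanced (fun v (c : k) => c *: v)
  (fun (c : k) b => alg_scale c b) (fun v b => lat_tens v (b * c)).
Proof.
have [tDl tDr tact] := lat_tens_balanced.
split=> [b v1 v2|v b1 b2|v r b] /=; first exact: tDl.
  by rewrite mulrDl; exact: tDr.
by rewrite /alg_scale -mulrA; exact: tact.
Qed.

Lemma colat_lact_balanced c : balanced (fun b (c : k) => alg_scale c b)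
  (fun (c : k) v => c *: v) (fun b v => colat_tens (c * b) v).
Proof.
have [tDl tDr tact] := colat_tens_balanced.
split=> [v b1 b2|b v1 v2|b r v] /=; last 1 first.
- by rewrite /alg_scale mulrA -alg_scalar_comm -mulrA; exact: tact.
- by rewrite mulrDr; exact: tDl.
- exact: tDr.
Qed.

Lemma flip_balanced : balanced (fun v (c : k) => c *: v)
  (fun (c : k) b => alg_scale c b) (fun v b => colat_tens b v).
Proof.
have [tDl tDr tact] := colat_tens_balanced.
split=> [b v1 v2|v b1 b2|v r b] /=; first exact: tDr; first exact: tDl.
by rewrite tact.
Qed.

Lemma lat_ractE v b c : lat_ract (lat_tens v b) c = lat_tens v (b * c).
Proof. by rewrite /lat_ract tensor_liftE //; exact: lat_ract_balanced. Qed.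

Lemma colat_lactE c b v : colat_lact c (colat_tens b v) = colat_tens (c * b) v.
Proof. by rewrite /colat_lact tensor_liftE //; exact: colat_lact_balanced. Qed.

Lemma flipE v b : flip (lat_tens v b) = colat_tens b v.
Proof. by rewrite /flip tensor_liftE //; exact: flip_balanced. Qed.

Lemma lat_ract_zmod_morphism c : zmod_morphism (fun x => @lat_ract k V B x c).
Proof. exact: tensor_liftB (lat_ract_balanced c). Qed.

Lemma colat_lact_zmod_morphism c : zmod_morphism (@colat_lact k V B c).
Proof. exact: tensor_liftB (colat_lact_balanced c). Qed.

Lemma flip_zmod_morphism : zmod_morphism (@flip k V B).
Proof. exact: tensor_liftB flip_balanced. Qed.

Section Involution.
Variable sigma : B -> B.
Hypothesis sigmaP : k_involution sigma.

Lemma lat_twist_balanced : balanced (fun v (c : k) => c *: v)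
  (fun (c : k) b => alg_scale c b) (fun v b => colat_tens (sigma b) v).
Proof.
have [tDl tDr tact] := flip_balanced.
split=> [b v1 v2|v b1 b2|v r b] /=; first exact: tDl.
  by rewrite (kinv_add sigmaP); exact: tDr.
by rewrite (kinv_scale sigmaP); exact: tact.
Qed.

Lemma colat_twist_balanced : balanced (fun b (c : k) => alg_scale c b)
  (fun (c : k) v => c *: v) (fun b v => lat_tens v (sigma b)).
Proof.
have [tDl tDr tact] := lat_tens_balanced.
split=> [v b1 b2|b v1 v2|b r v] /=; last 1 first.
- by rewrite (kinv_scale sigmaP); apply/esym; exact: tact.
- by rewrite (kinv_add sigmaP); exact: tDr.
- exact: tDl.
Qed.

Lemma lat_twistE v b : lat_twist sigma (lat_tens v b) = colat_tens (sigma b) v.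
Proof. by rewrite /lat_twist tensor_liftE //; exact: lat_twist_balanced. Qed.

Lemma colat_twistE b v :
  colat_twist sigma (colat_tens b v) = lat_tens v (sigma b).
Proof. by rewrite /colat_twist tensor_liftE //; exact: colat_twist_balanced. Qed.

Lemma lat_twist_zmod_morphism : zmod_morphism (@lat_twist k V B sigma).
Proof. exact: tensor_liftB lat_twist_balanced. Qed.

Lemma colat_twist_zmod_morphism : zmod_morphism (@colat_twist k V B sigma).
Proof. exact: tensor_liftB colat_twist_balanced. Qed.

Lemma theta_balanced : balanced (@lat_ract k V B) (@colat_lact k V B)
  (fun x y => sq_tens (colat_twist sigma y) (lat_twist sigma x)).
Proof.
have [tDl tDr tact] := sq_tens_balanced.
split=> [y x1 x2|x y1 y2|x c y] /=.
- by rewrite (zmod_morphismD lat_twist_zmod_morphism); exact: tDr.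
- by rewrite (zmod_morphismD colat_twist_zmod_morphism); exact: tDl.
have -> : lat_twist sigma (lat_ract x c) =
          colat_lact (sigma c) (lat_twist sigma x).
  elim/lat_ind: x => [v b|x1 x2 IH1 IH2].
    by rewrite lat_ractE !lat_twistE colat_lactE (kinv_mul sigmaP).
  by rewrite lat_ract_zmod_morphism !lat_twist_zmod_morphism
             colat_lact_zmod_morphism IH1 IH2.
have -> : colat_twist sigma (colat_lact c y) =
          lat_ract (colat_twist sigma y) (sigma c).
  elim/colat_ind: y => [b v|y1 y2 IH1 IH2].
    by rewrite colat_lactE !colat_twistE lat_ractE (kinv_mul sigmaP).
  by rewrite colat_lact_zmod_morphism !colat_twist_zmod_morphism
             lat_ract_zmod_morphism IH1 IH2.
by rewrite tact.
Qed.

Lemma thetaE v1 b1 b2 v2 :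
  theta sigma (sq_tens (lat_tens v1 b1) (colat_tens b2 v2)) =
  sq_tens (lat_tens v2 (sigma b2)) (colat_tens (sigma b1) v1).
Proof.
rewrite /theta tensor_liftE ?lat_twistE ?colat_twistE //.
exact: theta_balanced.
Qed.

End Involution.

Section Actions.
Variables (A : pzAlgType k) (i : A -> A).
Variable lact : A -> addEnd (cell_lattice V B).
Hypothesis lactP : bimodule (fun a x => lact a x) (@lat_ract k V B).

Lemma colat_ract_balanced a : balanced (fun b (c : k) => alg_scale c b)
  (fun (c : k) v => c *: v) (fun b v => flip (lact (i a) (lat_tens v b))).
Proof.
have [tDl tDr tact] := lat_tens_balanced.
split=> [v b1 b2|b v1 v2|b r v] /=.
- by rewrite tDr raddfD (zmod_morphismD flip_zmod_morphism).
- by rewrite tDl raddfD (zmod_morphismD flip_zmod_morphism).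
- by rewrite tact.
Qed.

Lemma colat_ractE b v a :
  colat_ract i lact (colat_tens b v) a = flip (lact (i a) (lat_tens v b)).
Proof. by rewrite /colat_ract tensor_liftE //; exact: colat_ract_balanced. Qed.

Lemma colat_ract_zmod_morphism a :
  zmod_morphism (fun y => colat_ract i lact y a).
Proof. exact: tensor_liftB (colat_ract_balanced a). Qed.

Lemma sq_lact_balanced a : balanced (@lat_ract k V B) (@colat_lact k V B)
  (fun x y => sq_tens (lact a x) y).
Proof.
have [tDl tDr tact] := sq_tens_balanced.
split=> [y x1 x2|x y1 y2|x c y] /=; first by rewrite raddfD; exact: tDl.
  exact: tDr.
by rewrite -(bimod_comm lactP); exact: tact.
Qed.

Lemma sq_lactE a x y : sq_lact lact a (sq_tens x y) = sq_tens (lact a x) y.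
Proof. by rewrite /sq_lact tensor_liftE //; exact: sq_lact_balanced. Qed.

Lemma sq_ract_balanced a : balanced (@lat_ract k V B) (@colat_lact k V B)
  (fun x y => sq_tens x (colat_ract i lact y a)).
Proof.
have [tDl tDr tact] := sq_tens_balanced.
have flip_ract (x : cell_lattice V B) c : flip (lat_ract x c) = colat_lact c (flip x).
  elim/lat_ind: x => [v b|x1 x2 IH1 IH2].
    by rewrite lat_ractE !flipE colat_lactE mulrC.
  by rewrite lat_ract_zmod_morphism !flip_zmod_morphism
             colat_lact_zmod_morphism IH1 IH2.
split=> [y x1 x2|x y1 y2|x c y] /=; first exact: tDl.
  by rewrite (zmod_morphismD (colat_ract_zmod_morphism a)); exact: tDr.
rewrite tact; congr (sq_tens x _); apply/esym.
elim/colat_ind: y => [b v|y1 y2 IH1 IH2].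
  by rewrite colat_lactE !colat_ractE -flip_ract (bimod_comm lactP) lat_ractE mulrC.
by rewrite colat_lact_zmod_morphism !colat_ract_zmod_morphism
           colat_lact_zmod_morphism IH1 IH2.
Qed.

Lemma sq_ractE x y a :
  sq_ract i lact (sq_tens x y) a = sq_tens x (colat_ract i lact y a).
Proof. by rewrite /sq_ract tensor_liftE //; exact: sq_ract_balanced. Qed.

End Actions.

End PureTensors.

(* J is an affine cell ideal of A with respect to i, with cell lattice
   V (x)_k B, on which A acts on the left by lact; n is the rank of V. *)
Record affine_cell_ideal (k : comPzRingType) (A : pzAlgType k) (i : A -> A)
    (J : twoSidedIdeal A) (n : nat) (V : lmodType k) (B : comPzAlgType k)
    (sigma : B -> B) (lact : A -> addEnd (cell_lattice V B)) : Prop := {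
  cell_stable : forall x : A, x \in J <-> exists2 y : A, y \in J & x = i y;
  cell_rank_gt0 : (0 < n)%N;
  cell_free : free_of_rank V n;
  cell_affine : affine_algebra B;
  cell_sigma : k_involution sigma;
  cell_bimodule : bimodule (fun a x => lact a x) (@lat_ract k V B);
  cell_iso : exists alpha : {additive ideal_elt J -> cell_square V B},
    [/\ bijective alpha,
        forall a x, alpha (ideal_lmul a x) = sq_lact lact a (alpha x),
        forall a x, alpha (ideal_rmul x a) = sq_ract i lact (alpha x) a
      & forall x y : ideal_elt J,
          val y = i (val x) -> alpha y = theta sigma (alpha x)]
}.

(* Main.v *)
From HB Require Import structures.
Require Import Defs.
From mathcomp Require Import all_boot all_algebra.
From mathcomp Require Import boolp.

Set Implicit Arguments.
Unset Strict Implicit.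
Unset Printing Implicit Defensive.

Import GRing.Theory.

(** A basis of V turns the cell lattice Delta into the columns 'cV[B]_n, the
lattice Delta' into the rows, and Delta (x)_B Delta' into 'M[B]_n.  Since A acts
on Delta by B-linear maps, a in A acts on Delta and on J, seen as 'M[B]_n, by
left multiplication by one matrix L a, and on the right of J by multiplication
by a matrix R a.  Comparing both descriptions of a product x y in J, at
y = 1%:M, gives L x = x psi for x in J, where psi is R of the element 1%:M
([ideal_lact_twist]).  Hence J is 'M[B]_n with the product X psi Y, and a map
of J-modules is an additive map f with f (X psi u) = X psi f u.

The heart of the matter is that under (a) or (b) such an f is linear for the
unital ring 'M[B]_n ([twisted_linear_is_linear]).  In case (a), 1 is a sum of
products X psi Y, so that P u is a sum of terms (P X) psi (Y u), which f
respects.  In case (b), a central non-zero divisor Z of J yields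
W = Z psi = psi Z, which is central and regular for the usual product of
matrices; W f (P u) = W P f u holds by moving W inside f, and W cancels.

An 'M[B]_n-linear endomorphism of 'M[B]_n is the right multiplication by its
value at 1, and one of 'cV[B]_n is the multiplication by a scalar of B, as in
the Morita correspondence between 'M[B]_n and B.  Right multiplications commute
with every L a, so the J-endomorphisms of J are A-linear.  With the left factor
applied first, right actions are ring homomorphisms
([module_end_ring_isomorphic]), which gives the two isomorphisms. *)

(** * Additive maps *)

Section AdditiveMaps.
Local Open Scope ring_scope.
Variables (U W : zmodType) (f : U -> W).
Hypothesis fD : {morph f : x y / x + y}.

Lemma morphD_zmod_morphism : zmod_morphism f.
Proof. by move=> x y; apply/(addIr (f y)); rewrite -fD !subrK. Qed.

Lemma morphD_sum (I : Type) (r : seq I) (F : I -> U) :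
  f (\sum_(j <- r) F j) = \sum_(j <- r) f (F j).
Proof. by apply: big_morph => //; apply/(addIr (f 0)); rewrite -fD !add0r. Qed.

End AdditiveMaps.

(** * Matrices with the product X psi Y *)

Section TwistedLinearity.
Local Open Scope ring_scope.
Variables (B : comPzRingType) (n : nat).

(** For the ideal 'M[B]_n with the product X psi Y, idempotence amounts to the
identity matrix being a sum of such products. *)
Definition twist_unital (psi : 'M[B]_n) : Prop :=
  exists s : seq ('M[B]_n * 'M[B]_n),
    1%:M = \sum_(q <- s) q.1 *m psi *m q.2.

Definition twist_central_regular (psi : 'M[B]_n) : Prop :=
  exists Z : 'M[B]_n, (forall X, Z *m psi *m X = X *m psi *m Z) /\
                      (forall X : 'M[B]_n, Z *m psi *m X = 0 -> X = 0).

(** Regularity on square matrices passes to n x p matrices because a column,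
repeated n times, is a square matrix. *)
Lemma mulmx_regular_cancel (W : 'M[B]_n) p :
  (forall X : 'M[B]_n, W *m X = 0 -> X = 0) ->
  injective (fun u : 'M[B]_(n, p) => W *m u).
Proof.
move=> Wreg u v Wuv; apply/eqP; rewrite -subr_eq0; apply/eqP/matrixP => r j.
have Wc : W *m (u - v) = 0 by rewrite mulmxBr Wuv subrr.
(* The square matrix whose columns all equal column j of u - v is killed by W. *)
have /Wreg/matrixP/(_ r r) :
    W *m ((u - v) *m (\matrix_(s < p, t < n) (s == j)%:R)) = 0.
  by rewrite mulmxA Wc mul0mx.
rewrite [LHS]mxE (bigD1 j) //= big1 => [|s /negPf sj].
  by rewrite addr0 [X in _ * X]mxE eqxx mulr1 => ->; rewrite !mxE.
by rewrite [X in _ * X]mxE sj mulr0.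
Qed.

(** If 1 is a sum of products X psi Y, then P u is the sum of the
(P X) psi (Y u), out of which f extracts P.  If Z is central and regular for
the twisted product, put W = Z psi = psi Z; then
W f (P u) = f (Z psi P u) = f (P psi Z u) = P psi f (Z u) = P W f u = W P f u. *)
Lemma twisted_linear_is_linear (psi : 'M[B]_n) m p
    (f : {additive 'M[B]_(n, m) -> 'M[B]_(n, p)}) :
    twist_unital psi \/ twist_central_regular psi ->
    (forall X u, f (X *m psi *m u) = X *m psi *m f u) ->
  forall P u, f (P *m u) = P *m f u.
Proof.
move=> [[s s1]|[Z [Zc Zreg]]] f_lin P u.
  have sE q (w : 'M[B]_(n, q)) : w = \sum_(q <- s) q.1 *m psi *m (q.2 *m w).
    rewrite -{1}[w]mul1mx s1 mulmx_suml.
    by apply: eq_bigr => q' _; rewrite mulmxA.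
  rewrite {1}(sE _ u) mulmx_sumr raddf_sum [in RHS](sE _ u) raddf_sum mulmx_sumr.
  by apply: eq_bigr => q _; rewrite f_lin 2![P *m (_ *m _)]mulmxA f_lin !mulmxA.
have ZE : Z *m psi = psi *m Z by have := Zc 1%:M; rewrite mulmx1 mul1mx.
have Zf w : Z *m psi *m f w = psi *m f (Z *m w).
  by rewrite -f_lin ZE -mulmxA -[psi in LHS]mul1mx f_lin mul1mx.
apply: (@mulmx_regular_cancel (Z *m psi)) => //=.
rewrite -f_lin mulmxA Zc -mulmxA f_lin -[P *m psi *m _]mulmxA -Zf.
by rewrite !mulmxA -[P *m Z *m psi]mulmxA ZE mulmxA -Zc ZE.
Qed.

Lemma mulmx_linear_sqE (f : 'M[B]_n -> 'M[B]_n) :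
  (forall P u, f (P *m u) = P *m f u) -> forall u, f u = u *m f 1%:M.
Proof. by move=> fP u; rewrite -fP mulmx1. Qed.

(** Writing u = (u *m delta_mx 0 j) *m delta_mx j 0 exhibits the column u as a
matrix multiple of one fixed column, which determines f. *)
Lemma mulmx_linear_colE (j : 'I_n) (f : 'cV[B]_n -> 'cV[B]_n) :
    (forall P u, f (P *m u) = P *m f u) ->
  forall u, f u = u *m (f (delta_mx j 0) j 0)%:M.
Proof.
move=> fP u; rewrite -{1}[u]mulmx1.
have -> : 1%:M = delta_mx 0 j *m delta_mx j 0 :> 'M[B]_1.
  by rewrite mul_delta_mx; apply/matrixP => r s; rewrite !mxE !ord1.
rewrite mulmxA fP -mulmxA; congr (_ *m _).
by rewrite -rowE [LHS]mx11_scalar !mxE.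
Qed.

End TwistedLinearity.

(** * Endomorphism rings given by a right action *)

Section RightActionIsomorphism.
Local Open Scope ring_scope.
Variables (S : Type) (M : zmodType) (act : S -> addEnd M).
Variables (C : pzRingType) (ra : M -> C -> M).
Hypothesis raP : right_action ra.
Hypothesis ra_act : forall s x c, ra (act s x) c = act s (ra x c).
Hypothesis ra_inj : forall c d, (forall x, ra x c = ra x d) -> c = d.
Hypothesis ra_surj : forall f : addEnd M, f \in module_end act ->
  exists c, forall x, f x = ra x c.

Let scal (f : module_end_ring act) : C := projT1 (cid (ra_surj (valP f))).

Let scalE (f : module_end_ring act) x : val f x = ra x (scal f).
Proof. exact: (projT2 (cid (ra_surj (valP f)))). Qed.

(** The map from C to the endomorphisms is multiplicative, rather than
anti-multiplicative, because endomorphisms compose with the left factor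
applied first. *)
Lemma module_end_ring_isomorphic : ring_isomorphic (module_end_ring act) C.
Proof.
have raB x : zmod_morphism (ra x) := morphD_zmod_morphism (ractDr raP x).
have scalB : zmod_morphism scal.
  move=> f g; apply: ra_inj => x; rewrite -scalE raB -!scalE.
  by rewrite raddfB.
have scalM : monoid_morphism scal.
  split=> [|f g]; apply: ra_inj => x; rewrite -scalE.
    by rewrite (ract1 raP).
  by rewrite (ractM raP) -!scalE.
pose F := GRing.isZmodMorphism.Build _ _ scal scalB.
pose G := GRing.isMonoidMorphism.Build _ _ scal scalM.
pose phi : {rmorphism module_end_ring act -> C} := HB.pack scal F G.
exists phi.
have raB1 c : zmod_morphism (ra^~ c) := morphD_zmod_morphism (ractDl raP c).
pose ract c : {additive M -> M} :=
  HB.pack (ra^~ c) (GRing.isZmodMorphism.Build _ _ (ra^~ c) (raB1 c)).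
have ract_end c : AddEnd (ract c) \in module_end act.
  by apply/asboolP => s x; exact: ra_act.
exists (fun c => ModuleEnd (ract_end c)) => [f|c].
  by apply: val_inj; apply: addEnd_eq => x; exact: esym (scalE f x).
by apply: ra_inj => x; rewrite -scalE.
Qed.

End RightActionIsomorphism.

(** * Matrix coordinates on the cell lattice and its square *)

Section Coordinates.
Local Open Scope ring_scope.
Variables (k : comPzRingType) (V : lmodType k) (B : comPzAlgType k).
Variables (n : nat) (e : 'I_n -> V).
Hypothesis eP : forall v, exists! c : 'rV[k]_n, v = \sum_(j < n) c 0 j *: e j.

Local Notation Delta := (cell_lattice V B).
Local Notation Delta' := (colattice V B).
Local Notation Square := (cell_square V B).

Definition vcoord (v : V) : 'rV[k]_n := projT1 (cid (eP v)).

Lemma vcoordK v : \sum_(j < n) vcoord v 0 j *: e j = v.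
Proof. by rewrite /vcoord; case: cid => c [] /= <-. Qed.

Lemma vcoord_sum (c : 'rV[k]_n) : vcoord (\sum_(j < n) c 0 j *: e j) = c.
Proof. by rewrite /vcoord; case: cid => d [] /= _; apply. Qed.

Lemma vcoordD v w : vcoord (v + w) = vcoord v + vcoord w.
Proof.
rewrite -[in LHS](vcoordK v) -[in LHS](vcoordK w) -big_split /=.
rewrite -[RHS]vcoord_sum; congr vcoord.
by apply: eq_bigr => j _; rewrite mxE scalerDl.
Qed.

Lemma vcoordZ c v : vcoord (c *: v) = c *: vcoord v.
Proof.
rewrite -[in LHS](vcoordK v) scaler_sumr -[RHS]vcoord_sum; congr vcoord.
by apply: eq_bigr => j _; rewrite mxE scalerA.
Qed.

Lemma vcoord_basis j : vcoord (e j) = delta_mx 0 j.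
Proof.
rewrite -[RHS]vcoord_sum; congr vcoord.
rewrite (bigD1 j) //= big1 => [|s /negPf sj]; rewrite mxE ?eqxx.
  by rewrite scale1r addr0.
by rewrite sj scale0r.
Qed.

Lemma alg_scale_mulr (c : k) (b d : B) : alg_scale c (b * d) = alg_scale c b * d.
Proof. by rewrite /alg_scale mulrA. Qed.

Lemma alg_scaleA (c d : k) (b : B) :
  alg_scale (d * c) b = alg_scale c (alg_scale d b).
Proof. by rewrite /alg_scale mulrA -rmorphM [c * d]mulrC. Qed.

Definition pure_col (v : V) (b : B) : 'cV[B]_n :=
  \col_j alg_scale (vcoord v 0 j) b.

Lemma pure_colDl b : {morph pure_col^~ b : v w / v + w}.
Proof.
by move=> v w; apply/colP => j; rewrite !mxE vcoordD mxE /alg_scale rmorphD mulrDl.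
Qed.

Lemma pure_colDr v : {morph pure_col v : b d / b + d}.
Proof. by move=> b d; apply/colP => j; rewrite !mxE /alg_scale mulrDr. Qed.

Lemma pure_colZ v c b : pure_col (c *: v) b = pure_col v (alg_scale c b).
Proof. by apply/colP => j; rewrite !mxE vcoordZ mxE alg_scaleA. Qed.

Lemma pure_colM v b c : pure_col v (b * c) = pure_col v b *m c%:M.
Proof. by apply/colP => j; rewrite !mxE big_ord1 !mxE mulr1n alg_scale_mulr. Qed.

Definition lat_col (x : Delta) : 'cV[B]_n := tensor_lift pure_col x.

Definition colat_row (y : Delta') : 'rV[B]_n :=
  tensor_lift (fun b v => (pure_col v b)^T) y.

Lemma pure_col_balanced :
  balanced (fun v (c : k) => c *: v) (fun (c : k) b => alg_scale c b) pure_col.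
Proof. by split; [exact: pure_colDl | exact: pure_colDr | exact: pure_colZ]. Qed.

Lemma pure_row_balanced :
  balanced (fun b (c : k) => alg_scale c b) (fun (c : k) v => c *: v)
           (fun b v => (pure_col v b)^T).
Proof.
split=> [v b d|b v w|b c v] /=; by rewrite ?pure_colDl ?pure_colDr ?linearD // pure_colZ.
Qed.

Fact lat_col_is_zmod_morphism : zmod_morphism lat_col.
Proof. exact: tensor_liftB pure_col_balanced. Qed.
HB.instance Definition _ :=
  GRing.isZmodMorphism.Build Delta 'cV[B]_n lat_col lat_col_is_zmod_morphism.

Fact colat_row_is_zmod_morphism : zmod_morphism colat_row.
Proof. exact: tensor_liftB pure_row_balanced. Qed.
HB.instance Definition _ :=
  GRing.isZmodMorphism.Build Delta' 'rV[B]_n colat_row colat_row_is_zmod_morphism.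

Lemma lat_colE v b : lat_col (lat_tens v b) = pure_col v b.
Proof. by rewrite /lat_col tensor_liftE //; exact: pure_col_balanced. Qed.

Lemma colat_rowE b v : colat_row (colat_tens b v) = (pure_col v b)^T.
Proof. by rewrite /colat_row tensor_liftE //; exact: pure_row_balanced. Qed.

Lemma lat_col_basis j b : lat_col (lat_tens (e j) b) = b *: delta_mx j 0.
Proof.
rewrite lat_colE; apply/colP => s; rewrite !mxE vcoord_basis mxE !eqxx andbT /=.
rewrite /alg_scale; case: (s == j); first by rewrite rmorph1 mulr1 mul1r.
by rewrite rmorph0 mulr0 mul0r.
Qed.

Lemma colat_row_basis b j : colat_row (colat_tens b (e j)) = b *: delta_mx 0 j.
Proof.
by rewrite colat_rowE -lat_colE lat_col_basis linearZ /= trmx_delta.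
Qed.

Lemma lat_col_ract x c : lat_col (lat_ract x c) = lat_col x *m c%:M.
Proof.
elim/lat_ind: x => [v b|x y IHx IHy].
  by rewrite lat_ractE !lat_colE pure_colM.
by rewrite lat_ract_zmod_morphism !raddfB /= IHx IHy mulmxBl.
Qed.

Lemma colat_row_lact c y : colat_row (colat_lact c y) = c%:M *m colat_row y.
Proof.
elim/colat_ind: y => [b v|x y IHx IHy].
  by rewrite colat_lactE !colat_rowE mulrC pure_colM trmx_mul tr_scalar_mx.
by rewrite colat_lact_zmod_morphism !raddfB /= IHx IHy.
Qed.

Lemma colat_row_flip x : colat_row (flip x) = (lat_col x)^T.
Proof.
elim/lat_ind: x => [v b|x y IHx IHy].
  by rewrite flipE colat_rowE lat_colE.
by rewrite flip_zmod_morphism !raddfB /= IHx IHy.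
Qed.

Definition lat_of_col (u : 'cV[B]_n) : Delta :=
  \sum_(j < n) lat_tens (e j) (u j 0).

Lemma lat_of_colB : zmod_morphism lat_of_col.
Proof.
have [_ tDr _] := @lat_tens_balanced k V B.
move=> u w; rewrite -sumrB; apply: eq_bigr => j _; rewrite !mxE.
exact: morphD_zmod_morphism (tDr _) _ _.
Qed.

Lemma lat_colK : cancel lat_col lat_of_col.
Proof.
have [tDl tDr tact] := @lat_tens_balanced k V B.
move=> x; elim/lat_ind: x => [v b|x y IHx IHy]; last first.
  by rewrite raddfB /= lat_of_colB IHx IHy.
rewrite lat_colE -[in RHS](vcoordK v) (morphD_sum (tDl b)).
by apply: eq_bigr => j _; rewrite mxE -tact.
Qed.

Lemma lat_of_colK : cancel lat_of_col lat_col.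
Proof.
move=> u; rewrite raddf_sum [RHS]matrix_sum_delta; apply: eq_bigr => j _.
by rewrite big_ord1 /= lat_col_basis.
Qed.

Lemma lat_of_col_scalar u c : lat_of_col (u *m c%:M) = lat_ract (lat_of_col u) c.
Proof.
by apply: (can_inj lat_colK); rewrite lat_of_colK lat_col_ract lat_of_colK.
Qed.

Lemma sq_mx_balanced :
  balanced (@lat_ract k V B) (@colat_lact k V B) (fun x y => lat_col x *m colat_row y).
Proof.
split=> [y x x'|x y y'|x c y] /=.
- by rewrite raddfD /= mulmxDl.
- by rewrite raddfD /= mulmxDr.
- by rewrite lat_col_ract colat_row_lact mulmxA.
Qed.

Definition sq_mx (t : Square) : 'M[B]_n :=
  tensor_lift (fun x y => lat_col x *m colat_row y) t.

Fact sq_mx_is_zmod_morphism : zmod_morphism sq_mx.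
Proof. exact: tensor_liftB sq_mx_balanced. Qed.
HB.instance Definition _ :=
  GRing.isZmodMorphism.Build Square 'M[B]_n sq_mx sq_mx_is_zmod_morphism.

Lemma sq_mxE x y : sq_mx (sq_tens x y) = lat_col x *m colat_row y.
Proof. by rewrite /sq_mx tensor_liftE //; exact: sq_mx_balanced. Qed.

(** In a tensor product over B all scalars can be moved into the first factor,
which leaves the elements 1 (x) e_j in the second one. *)
Definition sq_of_mx (X : 'M[B]_n) : Square :=
  \sum_(j < n) sq_tens (lat_of_col (col j X)) (colat_tens 1 (e j)).

Lemma sq_of_mxK : cancel sq_of_mx sq_mx.
Proof.
move=> X; rewrite raddf_sum [RHS]matrix_sum_delta exchange_big.
apply: eq_bigr => j _; rewrite /= sq_mxE lat_of_colK colat_row_basis scale1r.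
rewrite [col j X]matrix_sum_delta mulmx_suml; apply: eq_bigr => r _.
by rewrite big_ord1 mxE -scalemxAl mul_delta_mx.
Qed.

Lemma sq_of_mxB : zmod_morphism sq_of_mx.
Proof.
have [tDl _ _] := @sq_tens_balanced k V B.
move=> X Y; rewrite -sumrB; apply: eq_bigr => j _; rewrite raddfB /= lat_of_colB.
exact: morphD_zmod_morphism (tDl _) _ _.
Qed.

Lemma sq_mxK : cancel sq_mx sq_of_mx.
Proof.
have [sDl sDr sact] := @sq_tens_balanced k V B.
have [tDl tDr tact] := @colat_tens_balanced k V B.
move=> t; elim/tensor_ind: t => [x y|t u IHt IHu]; last first.
  by rewrite raddfB /= sq_of_mxB IHt IHu.
rewrite -/(sq_tens x y) sq_mxE; elim/colat_ind: y => [b v|y y' IHy IHy']; last first.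
  rewrite raddfB /= mulmxBr sq_of_mxB IHy IHy'.
  exact/esym/(morphD_zmod_morphism (sDr x)).
rewrite colat_rowE -[in RHS](vcoordK v) (morphD_sum (tDr b)) (morphD_sum (sDr x)).
apply: eq_bigr => j _.
have -> : col j (lat_col x *m (pure_col v b)^T) =
          lat_col x *m (alg_scale (vcoord v 0 j) b)%:M.
  by apply/colP => r; rewrite !mxE !big_ord1 !mxE mulr1n.
by rewrite lat_of_col_scalar lat_colK sact colat_lactE mulr1 -tact.
Qed.

Section Action.
Variables (A : pzAlgType k) (i : A -> A) (lact : A -> addEnd Delta).
Hypothesis lactP : bimodule (fun a x => lact a x) (@lat_ract k V B).

(** Column s is the image of e_s (x) 1; these elements generate Delta over B,
and the action of a commutes with B. *)
Definition lact_mx (a : A) : 'M[B]_n :=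
  \matrix_(r, s) lat_col (lact a (lat_tens (e s) 1)) r 0.

Lemma lat_col_lact a x : lat_col (lact a x) = lact_mx a *m lat_col x.
Proof.
rewrite -[in LHS](lat_colK x) /lat_of_col !raddf_sum.
apply/colP => r; rewrite summxE [RHS]mxE; apply: eq_bigr => j _.
rewrite /= -[lat_col x j 0]mul1r -lat_ractE -(bimod_comm lactP) lat_col_ract mul1r.
by rewrite mxE big_ord1 !mxE mulr1n.
Qed.

(** The right action of A on Delta' is transported from Delta by the flip and i;
as B is commutative, the flip becomes the transposition. *)
Lemma colat_row_ract y a :
  colat_row (colat_ract i lact y a) = colat_row y *m (lact_mx (i a))^T.
Proof.
elim/colat_ind: y => [b v|y y' IHy IHy'].
  rewrite colat_ractE // colat_row_flip lat_col_lact trmx_mul lat_colE.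
  by rewrite colat_rowE.
by rewrite colat_ract_zmod_morphism !raddfB /= IHy IHy' mulmxBl.
Qed.

Lemma sq_mx_lact a t : sq_mx (sq_lact lact a t) = lact_mx a *m sq_mx t.
Proof.
elim/tensor_ind: t => [x y|t u IHt IHu]; last first.
  have -> : sq_lact lact a (t - u) = sq_lact lact a t - sq_lact lact a u.
    exact: tensor_liftB (sq_lact_balanced lactP a) _ _.
  by rewrite !raddfB /= IHt IHu.
by rewrite -/(sq_tens x y) sq_lactE // !sq_mxE lat_col_lact mulmxA.
Qed.

Lemma sq_mx_ract t a :
  sq_mx (sq_ract i lact t a) = sq_mx t *m (lact_mx (i a))^T.
Proof.
elim/tensor_ind: t => [x y|t u IHt IHu]; last first.
  have -> : sq_ract i lact (t - u) a = sq_ract i lact t a - sq_ract i lact u a.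
    exact: tensor_liftB (sq_ract_balanced i lactP a) _ _.
  by rewrite !raddfB /= IHt IHu mulmxBl.
by rewrite -/(sq_tens x y) sq_ractE // !sq_mxE colat_row_ract mulmxA.
Qed.

End Action.

End Coordinates.

(** * Ideals that are full matrix bimodules *)

Section MatrixIdeal.
Local Open Scope ring_scope.
Variables (A : pzRingType) (J : twoSidedIdeal A).
Variables (B : comPzRingType) (n : nat).
Variables (L R : A -> 'M[B]_n) (beta : {additive ideal_elt J -> 'M[B]_n}).
Variable gamma : 'M[B]_n -> ideal_elt J.
Hypotheses (betaK : cancel beta gamma) (gammaK : cancel gamma beta).
Hypothesis beta_lmul : forall a x, beta (ideal_lmul a x) = L a *m beta x.
Hypothesis beta_rmul : forall a x, beta (ideal_rmul x a) = beta x *m R a.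

(** The matrix psi of the product of J.  That product is left and right
'M[B]_n-linear, so it is X (1 * 1) Y where 1 * 1 is the product in J of the
element of matrix 1%:M with itself, of matrix 1%:M *m R (val (gamma 1%:M)). *)
Definition twist : 'M[B]_n := R (val (gamma 1%:M)).

(** Both sides are the image of x times the element of matrix 1%:M, computed by
the left action and by the right action respectively. *)
Lemma ideal_lact_twist (x : ideal_elt J) : L (val x) = beta x *m twist.
Proof.
rewrite -beta_rmul -[LHS]mulmx1 -[1%:M in LHS]gammaK -beta_lmul.
by congr (beta _); apply: val_inj.
Qed.

Lemma beta_mul x y : beta (ideal_mul x y) = beta x *m twist *m beta y.
Proof. by rewrite beta_lmul ideal_lact_twist. Qed.

Lemma idempotent_twist_unital : idempotent_ideal J -> twist_unital twist.
Proof.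
move=> /(_ (val (gamma 1%:M))) [_ /(_ (valP _))] [s sE].
exists [seq (beta p.1, beta p.2) | p <- s].
rewrite big_map -[LHS]gammaK.
have -> : gamma 1%:M = \sum_(p <- s) ideal_mul p.1 p.2.
  by apply: val_inj; rewrite sE raddf_sum.
by rewrite raddf_sum; apply: eq_bigr => p _ /=; rewrite beta_mul.
Qed.

Lemma central_twist_regular (z : ideal_elt J) :
  ideal_central z -> ideal_non_zero_divisor z -> twist_central_regular twist.
Proof.
move=> zC zreg; exists (beta z); split=> X; rewrite -(gammaK X) -!beta_mul.
  by rewrite zC.
move=> zX; rewrite (zreg (gamma X)) ?raddf0 //; left.
by apply: (can_inj betaK); rewrite zX raddf0.
Qed.

Section MatrixEndomorphisms.
Hypothesis twistP : twist_unital twist \/ twist_central_regular twist.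

Definition ideal_mx_ract (x : ideal_elt J) (c : 'M[B]_n) : ideal_elt J :=
  gamma (beta x *m c).

Lemma ideal_mx_ractP : right_action ideal_mx_ract.
Proof.
split=> [c x y|x c d|x|c d x]; apply: (can_inj betaK); rewrite /ideal_mx_ract.
- by rewrite !(gammaK, raddfD) /= mulmxDl.
- by rewrite !(gammaK, raddfD).
- by rewrite gammaK mulmx1.
- by rewrite !gammaK mulmxA.
Qed.

Lemma ideal_mx_ract_act a x c :
  ideal_mx_ract (ideal_lact J a x) c = ideal_lact J a (ideal_mx_ract x c).
Proof.
by apply: (can_inj betaK); rewrite gammaK /= !beta_lmul gammaK mulmxA.
Qed.

Lemma ideal_self_endE (f : addEnd (ideal_elt J)) :
  f \in module_end (@ideal_self_lact A J) ->
  exists c, forall x, f x = ideal_mx_ract x c.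
Proof.
move=> /asboolP f_lin.
have gammaB : zmod_morphism gamma by exact: can2_zmod_morphism betaK gammaK.
pose g : {additive 'M[B]_n -> ideal_elt J} :=
  HB.pack gamma (GRing.isZmodMorphism.Build _ _ gamma gammaB).
pose F : {additive 'M[B]_n -> 'M[B]_n} := beta \o f \o g.
have F_lin : forall P u, F (P *m u) = P *m F u.
  apply: (twisted_linear_is_linear twistP) => X u /=.
  have -> : X *m twist *m u = beta (ideal_mul (gamma X) (gamma u)).
    by rewrite beta_mul !gammaK.
  rewrite betaK -[ideal_mul _ _]/(ideal_self_lact (gamma X) (gamma u)) f_lin.
  by rewrite /= beta_lmul ideal_lact_twist gammaK.
exists (F 1%:M) => x; apply: (can_inj betaK).
by rewrite gammaK -(mulmx_linear_sqE F_lin) /= betaK.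
Qed.

(** A J-linear map is a right multiplication by a matrix, and the left action
of all of A, being by matrices on the left, commutes with it. *)
Lemma module_end_ideal_eq :
  module_end (@ideal_lact A J) =i module_end (@ideal_self_lact A J).
Proof.
move=> f; apply/idP/idP => [/asboolP f_lin|/ideal_self_endE[c fE]].
  by apply/asboolP => x y; exact: f_lin.
by apply/asboolP => a x; rewrite !fE ideal_mx_ract_act.
Qed.

Lemma ideal_end_isomorphic :
  ring_isomorphic (module_end_ring (@ideal_lact A J)) 'M[B]_n.
Proof.
apply: (module_end_ring_isomorphic ideal_mx_ractP) => [a x c|c d cd|f].
- exact: ideal_mx_ract_act.
- have /(can_inj gammaK) := cd (gamma 1%:M).
  by rewrite gammaK !mul1mx.
- by rewrite module_end_ideal_eq; exact: ideal_self_endE.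
Qed.

(** The matrices L a by which A acts on J also describe its action on D, so by
[ideal_lact_twist] an A-linear f, read on columns, commutes with every X psi. *)
Lemma column_module_endE (D : zmodType) (act : A -> addEnd D) (j : 'I_n)
    (delta : {additive D -> 'cV[B]_n}) (delta' : 'cV[B]_n -> D) :
    cancel delta delta' -> cancel delta' delta ->
    (forall a x, delta (act a x) = L a *m delta x) ->
  forall f : addEnd D, f \in module_end act ->
  exists c : B, forall x, f x = delta' (delta x *m c%:M).
Proof.
move=> deltaK deltaK' delta_act f /asboolP f_lin.
have deltaB : zmod_morphism delta' by exact: can2_zmod_morphism deltaK deltaK'.
pose g : {additive 'cV[B]_n -> D} :=
  HB.pack delta' (GRing.isZmodMorphism.Build _ _ delta' deltaB).
pose F : {additive 'cV[B]_n -> 'cV[B]_n} := delta \o f \o g.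
have F_lin : forall P u, F (P *m u) = P *m F u.
  apply: (twisted_linear_is_linear twistP) => X u /=.
  have -> : X *m twist *m u = delta (act (val (gamma X)) (delta' u)).
    by rewrite delta_act deltaK' ideal_lact_twist gammaK.
  by rewrite deltaK f_lin delta_act ideal_lact_twist gammaK.
exists (F (delta_mx j 0) j 0) => x.
by apply: (can_inj deltaK); rewrite deltaK' -(mulmx_linear_colE j F_lin) /= deltaK.
Qed.

End MatrixEndomorphisms.
End MatrixIdeal.

(** * Endomorphisms of affine cell ideals and of cell lattices *)

Theorem theorem3p3 (k : comPzRingType) (A : pzAlgType k) (i : A -> A)
    (J : twoSidedIdeal A) (n : nat) (V : lmodType k) (B : comPzAlgType k)
    (sigma : B -> B) (lact : A -> addEnd (cell_lattice V B)) :
  noetherian k ->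
  k_involution i ->
  affine_cell_ideal i J n sigma lact ->
  idempotent_ideal J \/
    (exists z : ideal_elt J, ideal_central z /\ ideal_non_zero_divisor z) ->
  [/\ module_end (@ideal_lact A J) =i module_end (@ideal_self_lact A J),
      ring_isomorphic (module_end_ring (@ideal_lact A J)) 'M[B]_n
    & ring_isomorphic (module_end_ring lact) B].
Proof.
move=> _ _ [_ n_gt0 [e eP] _ _ lactP [alpha [[alpha' alphaK alphaK'] alphaL alphaR _]]].
pose beta : {additive ideal_elt J -> 'M[B]_n} := sq_mx eP \o alpha.
pose gamma X := alpha' (sq_of_mx e X).
pose L := lact_mx eP lact; pose R a := trmx (L (i a)).
have betaK : cancel beta gamma by move=> x; rewrite /gamma /= sq_mxK alphaK.
have gammaK : cancel gamma beta by move=> X; rewrite /gamma /= alphaK' sq_of_mxK.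
have betaL a x : beta (ideal_lmul a x) = mulmx (L a) (beta x).
  by rewrite /= alphaL sq_mx_lact.
have betaR a x : beta (ideal_rmul x a) = mulmx (beta x) (R a).
  by rewrite /= alphaR sq_mx_ract.
move=> J_cond.
have twistP : twist_unital (twist R gamma) \/ twist_central_regular (twist R gamma).
  case: J_cond => [Jidem|[z [zC zreg]]].
    by left; exact: (idempotent_twist_unital gammaK betaL betaR).
  by right; exact: (central_twist_regular betaK gammaK betaL betaR zC zreg).
split.
- exact: (module_end_ideal_eq betaK gammaK betaL betaR twistP).
- exact: (ideal_end_isomorphic betaK gammaK betaL betaR twistP).
pose j0 := Ordinal n_gt0.
apply: (module_end_ring_isomorphic (bimod_right lactP)) => [a x c|c d cd|f f_end].
- exact: (bimod_comm lactP).
(* Faithfulness: c is the coordinate at j0 of e_j0 (x) c, and n > 0. *)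
- have /(congr1 (fun x => lat_col eP x j0 ord0)) := cd (lat_tens (e j0) 1%R).
  rewrite !lat_ractE !lat_col_basis !mxE !eqxx.
  by rewrite !mulr1 !mul1r.
have [c fE] := column_module_endE gammaK betaL betaR twistP j0 (lat_colK eP)
  (lat_of_colK eP) (lat_col_lact eP lactP) f_end.
by exists c => x; rewrite fE (lat_of_col_scalar eP) lat_colK.
Qed.
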